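(* Consider the planar ODE $z_1'=-(z_2-\beta)$, $z_2'=z_1(1-e^{-\alpha z_2})$ on $\mathbb{R}\times[0,\infty)$, with parameters $\alpha,\beta>0$, and invariant manifold $\mathcal{M}=\{z_2=0\}$. Balancing the NILE (normal infinitesimal Lyapunov exponent) function $\mathcal{F}_\sigma$ along the trajectory in $\mathcal{M}$ starting at $(-b,0)$, $b>0$, yields the correct entry-exit relationship for this ODE, in the sense defined in the context.
   Context: Let $h(z)=(-(z_2-\beta),\,z_1(1-e^{-\alpha z_2}))^\top$ be the vector field, with flow $\phi_t^{t+s}$. For small $\chi>0$ consider the neighbourhood $\mathcal{E}(\chi)=\{z_2\in[0,\chi]\}$ of $\mathcal{M}$. A point particle transported by the flow enters at $(-b,\chi)$; by the symmetry $(z_1,z_2,t)\mapsto(-z_1,z_2,-t)$ its first exit from $\mathcal{E}(\chi)$ is at $(b,\chi)$. The reference trajectory in $\mathcal{M}$ is $\gamma(t)=(\beta(t-t_0)-b,0)^\top$. NILE: with $\mathrm{N}_p\mathcal{M}$ the normal space at $p\in\mathcal{M}$ and $\Pi_p$ the orthogonal projection of $\mathbb{R}^2=\mathrm{T}_p\mathcal{M}\oplus\mathrm{N}_p\mathcal{M}$ onto $\mathrm{N}_p\mathcal{M}$, $$\sigma(p;t):=\lim_{s\to0^+}\frac1s\ln\left\|\Pi_{\phi_t^{t+s}(p)}\,[\mathrm{D}\phi_t^{t+s}]\big|_{\mathrm{N}_p\mathcal{M}}\right\|,$$ which is known to equal $\max_{n}\,n^\top[\mathrm{D}_zh(p,t)]\,n$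 over unit normal vectors $n\in\mathrm{N}_p\mathcal{M}$ (this may also be used as the definition). The NILE balance function is $\mathcal{F}_\sigma(t)=\int_{t_0}^t\sigma(\gamma(s);s)\,\mathrm{d}s$. Balancing $\mathcal{F}_\sigma$ means taking as exit time the first nontrivial zero $T>t_0$ of $\mathcal{F}_\sigma$ and as exit point along $\mathcal{M}$ the point $\gamma(T)$; it yields the correct entry-exit relationship if $\gamma(T)=(b,0)$, i.e. $T=t_0+2b/\beta$. *)

(* Defs.v *)
(* Stdlib reals with Coquelicot.  Coquelicot's norm on R * R is the Euclidean
   one, so [norm] below is the norm of the plane. *)
From Stdlib Require Import Reals Lra.
From Coquelicot Require Import Coquelicot.
Open Scope R_scope.

Definition vector_field (alpha beta : R) (z : R * R) : R * R :=
  (- (snd z - beta), fst z * (1 - exp (- alpha * snd z))).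

Definition phase_space (z : R * R) : Prop := 0 <= snd z.

(* [phi t s p] is the state at time [s] of the solution through [p] at time
   [t], i.e. phi_t^s(p).  The field is locally Lipschitz and of linear growth on
   the half-plane, whose boundary is invariant, so solutions there exist for all
   times, backward ones included. *)
Definition is_flow (alpha beta : R) (phi : R -> R -> R * R -> R * R) : Prop :=
  forall (t : R) (p : R * R), phase_space p ->
    phi t t p = p /\
    forall s : R, phase_space (phi t s p) /\
      is_derive (fun r : R => phi t r p) s (vector_field alpha beta (phi t s p)).

Definition invariant_manifold (z : R * R) : Prop := snd z = 0.

Definition dot (u v : R * R) : R := fst u * fst v + snd u * snd v.

(* The invariant manifold is a line through the origin: its tangent space at
   each of its points is the line itself, so tangent and normal spaces do not
   depend on the base point. *)
Definition tangent (u : R * R) : Prop := invariant_manifold u.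

Definition normal (n : R * R) : Prop := forall u : R * R, tangent u -> dot n u = 0.

(* Orthogonal projection onto the normal space. *)
Definition normal_proj (v : R * R) : R * R := (0, snd v).

(* Operator norm of the projection of [L] restricted to the normal space. *)
Definition normal_opnorm (L : R * R -> R * R) : R :=
  real (Lub_Rbar (fun r : R => exists n : R * R,
    normal n /\ norm n = 1 /\ r = norm (normal_proj (L n)))).

(* [l] is the normal infinitesimal Lyapunov exponent sigma(p; t).  As [p] is on
   the boundary of the phase space, the derivative [L s] of phi_t^(t+s) at [p]
   is the Frechet derivative within the phase space; it is unique since a
   half-plane has nonempty interior. *)
Definition is_NILE (phi : R -> R -> R * R -> R * R) (p : R * R) (t l : R) : Prop :=
  exists L : R -> R * R -> R * R,
    (forall s : R, 0 < s ->
       filterdiff (phi t (t + s)) (within phase_space (locally p)) (L s)) /\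
    filterlim (fun s : R => 1 / s * ln (normal_opnorm (L s)))
      (at_right 0) (locally l).

(* The total operator attached to [is_NILE]; [iota] is definite description, as
   in Coquelicot's [RInt]. *)
Definition NILE (phi : R -> R -> R * R -> R * R) (p : R * R) (t : R) : R :=
  iota (fun l : R => is_NILE phi p t l).

Definition gamma (beta b t0 t : R) : R * R := (beta * (t - t0) - b, 0).

Definition NILE_balance (phi : R -> R -> R * R -> R * R) (beta b t0 t : R) : R :=
  RInt (fun s : R => NILE phi (gamma beta b t0 s) s) t0 t.

Definition first_zero_after (F : R -> R) (t0 T : R) : Prop :=
  t0 < T /\ F T = 0 /\ forall t : R, t0 < t < T -> F t <> 0.

Definition strip (chi : R) (z : R * R) : Prop := 0 <= snd z <= chi.

Definition enters (S : R * R -> Prop) (z : R -> R * R) (t : R) : Prop :=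
  at_left t (fun s : R => ~ S (z s)) /\ at_right t (fun s : R => S (z s)).

Definition first_exit (S : R * R -> Prop) (z : R -> R * R) (t0 T : R) : Prop :=
  t0 < T /\ (forall t : R, t0 <= t <= T -> S (z t)) /\
  forall eps : R, 0 < eps -> exists t : R, T < t < T + eps /\ ~ S (z t).

(* The point [p] of the invariant manifold is the correct exit point for the
   entry point (-b, 0): for all small chi, the particle that enters the strip
   at (-b, chi) first leaves it at the point of height chi above [p]. *)
Definition correct_exit_point
    (phi : R -> R -> R * R -> R * R) (b t0 : R) (p : R * R) : Prop :=
  invariant_manifold p /\
  exists chi0 : R, 0 < chi0 /\ forall chi : R, 0 < chi < chi0 ->
    enters (strip chi) (fun t : R => phi t0 t (- b, chi)) t0 /\
    exists Tx : R,
      first_exit (strip chi) (fun t : R => phi t0 t (- b, chi)) t0 Tx /\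
      phi t0 Tx (- b, chi) = (fst p, chi).

(* Main.v *)
Require Import Defs.
From Stdlib Require Import Reals Lra.
From Coquelicot Require Import Coquelicot.
Open Scope R_scope.

(** The NILE on the invariant manifold.  A normal vector based at (p1, 0) is
    transported along the solution (p1 + beta * u, 0), and its normal component
    is multiplied by the exponential of the integral of alpha * z_1.  The normal
    growth rate over a time [s] is therefore alpha * (p1 + beta * s / 2), and its
    limit is sigma = alpha * p1.  Along [gamma] the balance function is
    alpha * u * (beta * u / 2 - b) with u = t - t0, which vanishes at u = 0,
    first returns to zero at u = 2 * b / beta, and gives the exit point (b, 0).
    The flow is differentiable at the boundary point (p1, 0), within the
    half-plane, because the error of the linearization is quadratic
    ([variation_estimate]).  Since the half-plane contains the upward normal
    direction, the value of a differential on that direction is determined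
    ([filterdiff_vertical_unique]), so the NILE is the only limit
    ([is_NILE_iff]).

    The true exit point.  The field is invariant under
    (z_1, z_2, t) -> (-z_1, z_2, -t).  For chi < beta, a particle entering the
    strip at (-b, chi) does not rise as long as z_1 is nonpositive, hence stays
    in the strip, and z_1 grows at a rate of at least beta - chi; so it reaches
    the axis z_1 = 0 at some time tau ([axis_reached]).  By uniqueness of
    solutions ([solution_unique]), obtained from Gronwall's inequality, the
    trajectory is symmetric about tau ([axis_symmetry]).  It thus stays in the
    strip until 2 * tau - t0, when it is at (b, chi) with z_2 increasing
    ([exit_point_solution]). *)

(** * Calculus on the real line *)

Lemma increment_le (f df : R -> R) (a c M : R) :
  a <= c ->
  (forall r, a <= r <= c -> is_derive f r (df r)) ->
  (forall r, a <= r <= c -> df r <= M) ->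
  f c - f a <= M * (c - a).
Proof.
  intros Hac Hd HM.
  destruct (MVT_gen f a c df) as [x [Hx E]].
  - intros x Hx. rewrite Rmin_left, Rmax_right in Hx by lra.
    apply Hd; lra.
  - intros x Hx. rewrite Rmin_left, Rmax_right in Hx by lra.
    apply derivable_continuous_pt.
    exists (df x). apply is_derive_Reals, Hd; lra.
  - rewrite Rmin_left, Rmax_right in Hx by lra.
    rewrite E. apply Rmult_le_compat_r; [lra | now apply HM].
Qed.

Lemma increment_ge (f df : R -> R) (a c M : R) :
  a <= c ->
  (forall r, a <= r <= c -> is_derive f r (df r)) ->
  (forall r, a <= r <= c -> M <= df r) ->
  M * (c - a) <= f c - f a.
Proof.
  intros Hac Hd HM.
  assert (H : - f c - - f a <= - M * (c - a)).
  { apply (increment_le (fun r => - f r) (fun r => - df r)); [lra | |].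
    - intros r Hr. apply (is_derive_opp f), Hd, Hr.
    - intros r Hr. specialize (HM r Hr). lra. }
  lra.
Qed.

Lemma increment_abs_le (f df : R -> R) (a c M : R) :
  a <= c ->
  (forall r, a <= r <= c -> is_derive f r (df r)) ->
  (forall r, a <= r <= c -> Rabs (df r) <= M) ->
  Rabs (f c - f a) <= M * (c - a).
Proof.
  intros Hac Hd HM. apply Rabs_le. split.
  - rewrite Ropp_mult_distr_l. apply (increment_ge f df); auto.
    intros r Hr. specialize (HM r Hr). apply Rabs_le_between in HM. lra.
  - apply (increment_le f df); auto.
    intros r Hr. specialize (HM r Hr). apply Rabs_le_between in HM. lra.
Qed.

(** Gronwall's inequality in differential form. *)
Lemma gronwall (f df : R -> R) (a c K : R) :
  a <= c ->
  (forall r, a <= r <= c -> is_derive f r (df r)) ->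
  (forall r, a <= r <= c -> df r <= K * f r) ->
  f c <= f a * exp (K * (c - a)).
Proof.
  intros Hac Hd HK.
  assert (H : f c * exp (- K * (c - a)) - f a * exp (- K * (a - a)) <= 0 * (c - a)).
  { apply (increment_le (fun r => f r * exp (- K * (r - a)))
      (fun r => (df r - K * f r) * exp (- K * (r - a)))); [lra | |].
    - intros r Hr. specialize (Hd r Hr).
      auto_derive; [now exists (df r) |].
      replace (Derive (fun x : R => f x) r) with (df r)
        by (symmetry; apply (is_derive_unique f), Hd).
      unfold Rminus. ring.
    - intros r Hr. specialize (HK r Hr).
      pose proof (exp_pos (- K * (r - a))). nra. }
  replace (- K * (a - a)) with 0 in H by ring. rewrite exp_0 in H.
  apply Rmult_le_reg_r with (exp (- K * (c - a))); [apply exp_pos |].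
  rewrite Rmult_assoc, <- exp_plus.
  replace (K * (c - a) + - K * (c - a)) with 0 by ring.
  rewrite exp_0. lra.
Qed.

(** The first zero is the supremum of the times up to which the function stays
    negative. *)
Lemma first_zero_exists (f : R -> R) (a c : R) :
  (forall r, continuous f r) -> a <= c -> f a < 0 -> 0 <= f c ->
  exists tau, a < tau /\ f tau = 0 /\ forall r, a <= r < tau -> f r < 0.
Proof.
  intros Hf Hac Ha Hc.
  set (P := fun r => a <= r /\ forall u, a <= u <= r -> f u < 0).
  assert (HP : P a).
  { split; [lra |]. intros u Hu. replace u with a by lra. exact Ha. }
  destruct (completeness P) as [tau [Hub Hlub]].
  { exists c. intros r [Hr Hneg].
    destruct (Rle_lt_dec r c) as [H | H]; [exact H |].
    specialize (Hneg c). lra. }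
  { now exists a. }
  assert (Hat : a <= tau) by now apply Hub.
  assert (Hbelow : forall r, a <= r < tau -> f r < 0).
  { intros r Hr. destruct (Rlt_le_dec (f r) 0) as [H | H]; [exact H |].
    assert (tau <= r); [| lra].
    apply Hlub. intros u [Hu Hneg].
    destruct (Rle_lt_dec u r) as [Hur | Hur]; [exact Hur |].
    specialize (Hneg r). lra. }
  assert (Hloc : forall eps : posreal, exists d : posreal,
    forall r, Rabs (r - tau) < d -> Rabs (f r - f tau) < eps).
  { intros eps. destruct (Hf tau (ball (f tau) eps) (locally_ball _ eps)) as [d Hd].
    exists d. intros r Hr. apply (Hd r Hr). }
  assert (Hzero : f tau = 0).
  { destruct (total_order_T (f tau) 0) as [[H | H] | H]; [| exact H |].
    - destruct (Hloc (mkposreal (- f tau) ltac:(lra))) as [d Hd]. simpl in Hd.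
      assert (tau + d / 2 <= tau); [| pose proof (cond_pos d); lra].
      apply Hub. split; [pose proof (cond_pos d); lra |].
      intros u Hu. destruct (Rlt_le_dec u tau) as [H1 | H1]; [apply Hbelow; lra |].
      assert (Hu' : Rabs (u - tau) < d)
        by (pose proof (cond_pos d); apply Rabs_def1; lra).
      apply Hd, Rabs_def2 in Hu'. lra.
    - destruct (Hloc (mkposreal (f tau) H)) as [d Hd]. simpl in Hd.
      pose proof (cond_pos d) as Hdp.
      assert (Hlt : a < tau).
      { destruct Hat as [Hat | Hat]; [exact Hat | subst; lra]. }
      set (u := Rmax a (tau - d / 2)).
      assert (Hu : a <= u < tau /\ tau - d / 2 <= u).
      { unfold u. repeat split; [apply Rmax_l | apply Rmax_lub_lt; lra | apply Rmax_r]. }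
      assert (Hu' : Rabs (u - tau) < d) by (apply Rabs_def1; lra).
      apply Hd, Rabs_def2 in Hu'. specialize (Hbelow u). lra. }
  exists tau. split; [| now split].
  destruct Hat as [Hat | Hat]; [exact Hat |]. subst. lra.
Qed.

Lemma derive_pos_locally (f : R -> R) (t l : R) :
  is_derive f t l -> 0 < l ->
  exists d : posreal, forall s, Rabs (s - t) < d ->
    (t < s -> f t < f s) /\ (s < t -> f s < f t).
Proof.
  intros H Hl. apply is_derive_Reals in H.
  destruct (H (l / 2) ltac:(lra)) as [d Hd].
  exists d. intros s Hs.
  destruct (Req_dec s t) as [-> | Hst]; [lra |].
  specialize (Hd (s - t) ltac:(lra) Hs).
  replace (t + (s - t)) with s in Hd by ring.
  apply Rabs_def2 in Hd.
  set (q := (f s - f t) / (s - t)) in *.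
  assert (E : f s - f t = q * (s - t)) by (unfold q; field; lra).
  split; intros; nra.
Qed.

Lemma exp_opp_bounds (u : R) : 0 <= u -> 0 <= 1 - exp (- u) <= u.
Proof.
  intros Hu. pose proof (exp_ineq1_le (- u)).
  split; [| lra].
  apply Rle_minus_r. rewrite Rplus_0_l, <- exp_0.
  destruct Hu as [Hu | <-]; [| rewrite Ropp_0; lra].
  apply Rlt_le, exp_increasing. lra.
Qed.

Lemma exp_opp_taylor (u : R) : 0 <= u -> Rabs (1 - exp (- u) - u) <= u ^ 2.
Proof.
  intros Hu. pose proof (exp_opp_bounds u Hu).
  pose proof (exp_ineq1_le u).
  assert (E : exp (- u) * exp u = 1).
  { rewrite <- exp_plus, <- exp_0. f_equal. ring. }
  pose proof (exp_pos (- u)).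
  apply Rabs_le. split; [| nra].
  assert (exp (- u) * (1 + u) <= 1) by nra.
  nra.
Qed.

Lemma exp_opp_lipschitz (u v : R) :
  0 <= u -> 0 <= v -> Rabs (exp (- u) - exp (- v)) <= Rabs (u - v).
Proof.
  assert (W : forall u v, 0 <= u <= v -> Rabs (exp (- u) - exp (- v)) <= Rabs (u - v)).
  { clear u v. intros u v Huv.
    assert (E : exp (- v) = exp (- u) * exp (- (v - u))).
    { rewrite <- exp_plus. f_equal. ring. }
    pose proof (exp_opp_bounds (v - u) ltac:(lra)).
    pose proof (exp_opp_bounds u ltac:(lra)).
    pose proof (exp_pos (- u)).
    rewrite (Rabs_left1 (u - v)) by lra.
    rewrite E. apply Rabs_le. split; nra. }
  intros Hu Hv. destruct (Rle_dec u v) as [H | H].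
  - apply W; lra.
  - rewrite Rabs_minus_sym, (Rabs_minus_sym u). apply W; lra.
Qed.

(** * Solutions of the planar system *)

(** [x] and [y] are the components of a solution, defined for all times, with
    values in the closed upper half-plane. *)
Definition is_solution (alpha beta : R) (x y : R -> R) : Prop :=
  forall r : R, 0 <= y r /\
    is_derive x r (beta - y r) /\
    is_derive y r (x r * (1 - exp (- (alpha * y r)))).

Lemma is_derive_fst (f : R -> R * R) (t : R) (l : R * R) :
  is_derive f t l -> is_derive (fun r => fst (f r)) t (fst l).
Proof.
  intros H.
  apply (filterdiff_comp' f fst t (fun y => scal y l) fst H).
  apply filterdiff_linear, is_linear_fst.
Qed.

Lemma is_derive_snd (f : R -> R * R) (t : R) (l : R * R) :
  is_derive f t l -> is_derive (fun r => snd (f r)) t (snd l).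
Proof.
  intros H.
  apply (filterdiff_comp' f snd t (fun y => scal y l) snd H).
  apply filterdiff_linear, is_linear_snd.
Qed.

Lemma flow_solution (alpha beta : R) (phi : R -> R -> R * R -> R * R) (t : R) (p : R * R) :
  is_flow alpha beta phi -> phase_space p ->
  is_solution alpha beta (fun r => fst (phi t r p)) (fun r => snd (phi t r p)).
Proof.
  intros Hphi Hp r. destruct (Hphi t p Hp) as [_ H].
  destruct (H r) as [Hpos Hd].
  split; [exact Hpos | split].
  - replace (beta - snd (phi t r p)) with (fst (vector_field alpha beta (phi t r p)))
      by (simpl; ring).
    exact (is_derive_fst _ _ _ Hd).
  - replace (fst (phi t r p) * (1 - exp (- (alpha * snd (phi t r p)))))
      with (snd (vector_field alpha beta (phi t r p)))
      by (simpl; do 3 f_equal; ring).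
    exact (is_derive_snd _ _ _ Hd).
Qed.

(** The reversing symmetry (z_1, z_2, t) -> (-z_1, z_2, -t), about the time
    [c / 2]. *)
Lemma reversed_solution (alpha beta : R) (x y : R -> R) (c : R) :
  is_solution alpha beta x y ->
  is_solution alpha beta (fun r => - x (c - r)) (fun r => y (c - r)).
Proof.
  intros H r. destruct (H (c - r)) as [Hy [Hdx Hdy]].
  split; [exact Hy | split].
  - auto_derive; [now exists (beta - y (c - r)) |].
    replace (Derive (fun x0 : R => x x0) (c + - r)) with (beta - y (c - r))
      by (symmetry; apply is_derive_unique; exact Hdx).
    ring.
  - auto_derive; [now exists (x (c - r) * (1 - exp (- (alpha * y (c - r))))) |].
    replace (Derive (fun x0 : R => y x0) (c + - r))
      with (x (c - r) * (1 - exp (- (alpha * y (c - r)))))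
      by (symmetry; apply is_derive_unique; exact Hdy).
    ring.
Qed.

Lemma solution_on_manifold (alpha beta k t0 : R) :
  is_solution alpha beta (fun r => beta * (r - t0) + k) (fun _ => 0).
Proof.
  intros r. split; [lra | split].
  - auto_derive; [auto |]. ring.
  - rewrite Rmult_0_r, Ropp_0, exp_0, Rminus_diag, Rmult_0_r.
    apply (is_derive_const (K := R_AbsRing) (V := R_NormedModule) 0 r).
Qed.

Lemma solution_continuous_fst (alpha beta : R) (x y : R -> R) :
  is_solution alpha beta x y -> forall r, continuous x r.
Proof.
  intros H r. apply (ex_derive_continuous x).
  exists (beta - y r). apply H.
Qed.

(** Forward uniqueness: Gronwall's inequality for the squared distance.  The
    field is Lipschitz where the first coordinate is bounded. *)
Lemma solution_unique_forward (alpha beta : R) (x1 y1 x2 y2 : R -> R) (a c : R) :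
  0 < alpha ->
  is_solution alpha beta x1 y1 -> is_solution alpha beta x2 y2 ->
  a <= c -> x1 a = x2 a -> y1 a = y2 a -> x1 c = x2 c /\ y1 c = y2 c.
Proof.
  intros Hal H1 H2 Hac Hx Hy.
  destruct (continuity_ab_maj (fun r => Rabs (x2 r)) a c Hac) as [m [Hm _]].
  { intros r _. apply (continuity_pt_comp x2 Rabs); [| apply Rcontinuity_abs].
    apply continuity_pt_filterlim, (solution_continuous_fst alpha beta x2 y2 H2). }
  set (K := Rabs (x2 m)) in *.
  assert (HK : 0 <= K) by apply Rabs_pos.
  set (D := fun r => (x1 r - x2 r) ^ 2 + (y1 r - y2 r) ^ 2).
  set (dD := fun r => 2 * ((x1 r - x2 r) * (y2 r - y1 r)
     + (y1 r - y2 r) * (x1 r * (1 - exp (- (alpha * y1 r)))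
                        - x2 r * (1 - exp (- (alpha * y2 r)))))).
  assert (HD : D c <= D a * exp ((2 + 2 * (alpha * K)) * (c - a))).
  { apply (gronwall D dD); [exact Hac | |].
    - intros r _. destruct (H1 r) as [_ [Hx1 Hy1]]. destruct (H2 r) as [_ [Hx2 Hy2]].
      unfold D. auto_derive.
      { repeat split; eexists; eassumption. }
      rewrite (is_derive_unique (fun x : R => x1 x) _ _ Hx1), (is_derive_unique (fun x : R => y1 x) _ _ Hy1),
        (is_derive_unique (fun x : R => x2 x) _ _ Hx2), (is_derive_unique (fun x : R => y2 x) _ _ Hy2).
      unfold dD. ring.
    - intros r Hr. unfold D, dD. specialize (Hm r Hr). simpl in Hm. fold K in Hm.
      destruct (H1 r) as [Hp1 _]. destruct (H2 r) as [Hp2 _].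
      assert (Hq1 : 0 <= alpha * y1 r) by nra.
      assert (Hq2 : 0 <= alpha * y2 r) by nra.
      pose proof (exp_opp_lipschitz _ _ Hq2 Hq1) as HL.
      pose proof (exp_opp_bounds _ Hq1) as HB.
      pose proof (exp_pos (- (alpha * y1 r))) as HE.
      replace (alpha * y2 r - alpha * y1 r) with (alpha * - (y1 r - y2 r)) in HL by ring.
      rewrite Rabs_mult, Rabs_Ropp, (Rabs_right alpha) in HL by lra.
      set (e1 := exp (- (alpha * y1 r))) in *. set (e2 := exp (- (alpha * y2 r))) in *.
      set (u := x1 r - x2 r). set (v := y1 r - y2 r) in *.
      replace (_ + (y1 r - y2 r) * _) with (- (u * v) * e1 + v * (x2 r * (e2 - e1)))
        by (unfold u, v; ring).
      assert (G1 : - (u * v) * e1 <= u ^ 2 + v ^ 2).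
      { apply Rle_trans with (Rabs (u * v) * 1).
        - apply Rle_trans with (Rabs (u * v) * e1).
          + apply Rmult_le_compat_r; [lra |]. apply Rabs_maj2.
          + apply Rmult_le_compat_l; [apply Rabs_pos | lra].
        - rewrite Rmult_1_r. apply Rabs_le. split; nra. }
      assert (G2 : v * (x2 r * (e2 - e1)) <= alpha * K * v ^ 2).
      { apply Rle_trans with (Rabs (v * (x2 r * (e2 - e1)))); [apply Rle_abs |].
        rewrite !Rabs_mult.
        replace (alpha * K * v ^ 2) with (Rabs v * (K * (alpha * Rabs v))).
        - apply Rmult_le_compat_l; [apply Rabs_pos |].
          apply Rmult_le_compat; try apply Rabs_pos; assumption.
        - replace (v ^ 2) with (Rabs v ^ 2) by apply pow2_abs. ring. }
      assert (0 <= alpha * K * u ^ 2).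
      { apply Rmult_le_pos; [nra | apply pow2_ge_0]. }
      nra. }
  assert (E : D a = 0) by (unfold D; rewrite Hx, Hy; ring).
  rewrite E, Rmult_0_l in HD. unfold D in HD.
  pose proof (pow2_ge_0 (x1 c - x2 c)). pose proof (pow2_ge_0 (y1 c - y2 c)).
  split; apply Rminus_diag_uniq, Rsqr_0_uniq; unfold Rsqr; nra.
Qed.

Lemma solution_unique (alpha beta : R) (x1 y1 x2 y2 : R -> R) (a c : R) :
  0 < alpha ->
  is_solution alpha beta x1 y1 -> is_solution alpha beta x2 y2 ->
  x1 a = x2 a -> y1 a = y2 a -> x1 c = x2 c /\ y1 c = y2 c.
Proof.
  intros Hal H1 H2 Hx Hy.
  destruct (Rle_lt_dec a c) as [Hac | Hac].
  { now apply (solution_unique_forward alpha beta x1 y1 x2 y2 a c). }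
  destruct (solution_unique_forward alpha beta
    (fun r => - x1 (a + c - r)) (fun r => y1 (a + c - r))
    (fun r => - x2 (a + c - r)) (fun r => y2 (a + c - r)) c a) as [Ex Ey]; auto.
  - now apply reversed_solution.
  - now apply reversed_solution.
  - lra.
  - replace (a + c - c) with a by ring. now rewrite Hx.
  - now replace (a + c - c) with a by ring.
  - replace (a + c - a) with c in * by ring. split; [lra | exact Ey].
Qed.

(** * Entry and exit *)

Lemma height_nonincreasing (alpha beta : R) (x y : R -> R) (a c : R) :
  0 < alpha -> is_solution alpha beta x y -> a <= c ->
  (forall r, a <= r <= c -> x r <= 0) -> y c <= y a.
Proof.
  intros Hal H Hac Hx.
  assert (y c - y a <= 0 * (c - a)); [| lra].
  apply (increment_le y (fun r => x r * (1 - exp (- (alpha * y r))))); [exact Hac | |].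
  - intros r _. apply H.
  - intros r Hr. specialize (Hx r Hr). destruct (H r) as [Hy _].
    pose proof (exp_opp_bounds (alpha * y r) ltac:(nra)). nra.
Qed.

(** While the first coordinate is negative the height does not increase, so the
    first coordinate grows at a rate bounded below. *)
Lemma axis_reached (alpha beta b chi t0 : R) (x y : R -> R) :
  0 < alpha -> 0 < b -> chi < beta -> is_solution alpha beta x y ->
  x t0 = - b -> y t0 = chi ->
  exists tau, t0 < tau /\ x tau = 0 /\ forall r, t0 <= r < tau -> x r < 0.
Proof.
  intros Hal Hb Hchi H Hx0 Hy0.
  set (t1 := t0 + b / (beta - chi)).
  assert (Ht1 : (beta - chi) * (t1 - t0) = b) by (unfold t1; field; lra).
  assert (Hlt : t0 < t1) by nra.
  assert (Hc : exists c, t0 <= c /\ 0 <= x c).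
  { destruct (Rle_lt_dec 0 (x t1)) as [H1 | H1]; [exists t1; lra |].
    destruct (Classical_Prop.classic (exists c, t0 <= c <= t1 /\ 0 <= x c))
      as [[c [Hc1 Hc2]] | Hn]; [exists c; lra |].
    exfalso.
    assert (Hneg : forall r, t0 <= r <= t1 -> x r <= 0).
    { intros r Hr. apply Rnot_lt_le. intros Hr'. apply Hn. exists r. lra. }
    assert ((beta - chi) * (t1 - t0) <= x t1 - x t0); [| lra].
    apply (increment_ge x (fun r => beta - y r)); [lra | |].
    - intros r _. apply H.
    - intros r Hr. rewrite <- Hy0.
      assert (y r <= y t0); [| lra].
      apply (height_nonincreasing alpha beta x y); auto; [lra |].
      intros u Hu. apply Hneg. lra. }
  destruct Hc as [c [Hc1 Hc2]].
  apply (first_zero_exists x t0 c); auto.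
  - now apply (solution_continuous_fst alpha beta x y).
  - lra.
Qed.

Lemma axis_symmetry (alpha beta tau : R) (x y : R -> R) :
  0 < alpha -> is_solution alpha beta x y -> x tau = 0 ->
  forall r, x (2 * tau - r) = - x r /\ y (2 * tau - r) = y r.
Proof.
  intros Hal H Htau r.
  destruct (solution_unique alpha beta
    (fun u => - x (2 * tau - u)) (fun u => y (2 * tau - u)) x y tau r) as [Ex Ey]; auto.
  - now apply reversed_solution.
  - replace (2 * tau - tau) with tau by ring. lra.
  - now replace (2 * tau - tau) with tau by ring.
  - simpl in *. split; [lra | exact Ey].
Qed.

(** The particle entering the strip at (-b, chi) reaches the axis z_1 = 0 at
    some time [tau], and the symmetry about [tau] sends the entry to the exit. *)
Lemma exit_point_solution (alpha beta b chi t0 : R) (x y : R -> R) :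
  0 < alpha -> 0 < b -> 0 < chi < beta -> is_solution alpha beta x y ->
  x t0 = - b -> y t0 = chi ->
  enters (strip chi) (fun t => (x t, y t)) t0 /\
  exists Tx, first_exit (strip chi) (fun t => (x t, y t)) t0 Tx /\
    x Tx = b /\ y Tx = chi.
Proof.
  intros Hal Hb Hchi H Hx0 Hy0.
  destruct (axis_reached alpha beta b chi t0 x y) as [tau [Ht [Hx Hneg]]]; auto; [lra |].
  pose proof (axis_symmetry alpha beta tau x y Hal H Hx) as Hsym.
  assert (Hxneg : forall r, t0 <= r <= tau -> x r <= 0).
  { intros r Hr. destruct (Req_dec r tau) as [-> | Hn]; [lra |].
    apply Rlt_le, Hneg. lra. }
  assert (Hleft : forall r, t0 <= r <= tau -> y r <= chi).
  { intros r Hr. rewrite <- Hy0.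
    apply (height_nonincreasing alpha beta x y); auto; [lra |].
    intros u Hu. apply Hxneg. lra. }
  set (Tx := 2 * tau - t0).
  destruct (Hsym t0) as [HxT HyT]. fold Tx in HxT, HyT.
  assert (Hg : 0 < 1 - exp (- (alpha * chi))).
  { assert (exp (- (alpha * chi)) < exp 0) by (apply exp_increasing; nra).
    rewrite exp_0 in *. lra. }
  split; [| exists Tx; split; [| split; lra]].
  - destruct (H t0) as [_ [_ Hdy]]. rewrite Hx0, Hy0 in Hdy.
    destruct (derive_pos_locally (fun r => - y r) t0 (b * (1 - exp (- (alpha * chi)))))
      as [d Hd].
    { replace (b * (1 - exp (- (alpha * chi))))
        with (- (- b * (1 - exp (- (alpha * chi))))) by ring.
      now apply (is_derive_opp y). }
    { nra. }
    split; exists d; intros s Hs Hst; destruct (Hd s Hs) as [Hr Hl]; unfold strip; simpl.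
    + specialize (Hl Hst). lra.
    + specialize (Hr Hst). destruct (H s) as [Hp _]. lra.
  - split; [unfold Tx; lra | split].
    + intros t Htt. unfold strip; simpl. split; [apply H |].
      destruct (Rle_lt_dec t tau) as [Hc | Hc]; [apply Hleft; lra |].
      destruct (Hsym t) as [_ <-]. apply Hleft. unfold Tx in Htt. lra.
    + intros eps Heps. destruct (H Tx) as [_ [_ Hdy]].
      destruct (derive_pos_locally y Tx _ Hdy) as [d Hd].
      { rewrite HxT, HyT, Hx0, Hy0. nra. }
      pose proof (cond_pos d) as Hdp.
      set (m := Rmin (d / 2) (eps / 2)).
      assert (Hm : 0 < m /\ m <= d / 2 /\ m <= eps / 2).
      { unfold m. repeat split; [apply Rmin_glb_lt; lra | apply Rmin_l | apply Rmin_r]. }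
      exists (Tx + m). split; [lra |].
      destruct (Hd (Tx + m)) as [Hr _]; [apply Rabs_def1; lra |].
      unfold strip; simpl. specialize (Hr ltac:(lra)). lra.
Qed.

(** * Linearization of the flow along the invariant manifold *)

(** Logarithm of the factor by which a normal vector based at (p1, 0) has grown
    after time [u]: the integral of alpha * z_1 along (p1 + beta * u, 0). *)
Definition log_growth (alpha beta p1 u : R) : R :=
  alpha * (p1 * u + beta * u ^ 2 / 2).

(** Factor by which a normal vector has grown after time [u]. *)
Definition growth (alpha beta p1 u : R) : R := exp (log_growth alpha beta p1 u).

Lemma is_derive_log_growth (alpha beta p1 t r : R) :
  is_derive (fun r => log_growth alpha beta p1 (r - t)) r
    (alpha * (p1 + beta * (r - t))).
Proof.
  unfold log_growth. auto_derive; [auto |]. field.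
Qed.

Lemma growth_continuous (alpha beta p1 u : R) :
  continuous (growth alpha beta p1) u.
Proof.
  apply (ex_derive_continuous (growth alpha beta p1)).
  unfold growth, log_growth. auto_derive. auto.
Qed.

Lemma is_derive_RInt_growth (alpha beta p1 t r : R) :
  is_derive (fun r => RInt (growth alpha beta p1) 0 (r - t)) r
    (growth alpha beta p1 (r - t)).
Proof.
  assert (H : is_derive (RInt (growth alpha beta p1) 0) (r - t)
    (growth alpha beta p1 (r - t))).
  { apply (is_derive_RInt (growth alpha beta p1) _ 0).
    - apply filter_forall. intros u. apply (RInt_correct (growth alpha beta p1)).
      apply (ex_RInt_continuous (growth alpha beta p1)).
      intros v _. apply growth_continuous.
    - apply growth_continuous. }
  replace (growth alpha beta p1 (r - t)) with (1 * growth alpha beta p1 (r - t)) by ring.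
  apply (is_derive_comp (RInt (growth alpha beta p1) 0) (fun r => r - t) r); [exact H |].
  auto_derive; [auto | ring].
Qed.

Lemma log_growth_abs_le (alpha beta p1 s u : R) :
  0 < alpha -> 0 < beta -> 0 <= u <= s ->
  Rabs (log_growth alpha beta p1 u) <= alpha * (Rabs p1 + 1 + beta * s) * s.
Proof.
  intros Hal Hb Hu. unfold log_growth.
  rewrite Rabs_mult, (Rabs_right alpha), Rmult_assoc by lra.
  apply Rmult_le_compat_l; [lra |].
  pose proof (Rabs_pos p1).
  eapply Rle_trans; [apply Rabs_triang |].
  rewrite Rabs_mult, (Rabs_right u) by lra.
  assert (0 <= u ^ 2 <= s ^ 2) by (split; [apply pow2_ge_0 | apply pow_incr; lra]).
  assert (0 <= beta * u ^ 2 <= beta * s ^ 2).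
  { split; [apply Rmult_le_pos | apply Rmult_le_compat_l]; lra. }
  rewrite (Rabs_right (beta * u ^ 2 / 2)) by lra.
  nra.
Qed.

Lemma abscissa_le (alpha beta : R) (x y : R -> R) (t r : R) :
  is_solution alpha beta x y -> t <= r -> x r <= x t + beta * (r - t).
Proof.
  intros H Hr.
  assert (x r - x t <= beta * (r - t)); [| lra].
  apply (increment_le x (fun r => beta - y r)); [exact Hr | |]; intros u _.
  - apply H.
  - destruct (H u) as [Hy _]. lra.
Qed.

Lemma height_le (alpha beta : R) (x y : R -> R) (t r K : R) :
  0 < alpha -> 0 <= K -> is_solution alpha beta x y -> t <= r ->
  (forall u, t <= u <= r -> x u <= K) ->
  y r <= y t * exp (alpha * K * (r - t)).
Proof.
  intros Hal HK H Hr Hx.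
  apply (gronwall y (fun u => x u * (1 - exp (- (alpha * y u))))); [exact Hr | |].
  - intros u _. apply H.
  - intros u Hu. specialize (Hx u Hu). destruct (H u) as [Hy _].
    pose proof (exp_opp_bounds (alpha * y u) ltac:(nra)).
    apply Rle_trans with (K * (1 - exp (- (alpha * y u)))).
    + apply Rmult_le_compat_r; lra.
    + replace (alpha * K * y u) with (K * (alpha * y u)) by ring.
      apply Rmult_le_compat_l; lra.
Qed.

(** Quadratic bound on the remainder of the linearization at (p1, 0).  On
    [t, t + s] the height is at most [C * y t]; hence [x] is within
    [Rabs (x t - p1) + C * s * y t] of p1 + beta * (r - t), and the height divided
    by the growth factor has a small derivative. *)
Lemma variation_estimate (alpha beta p1 t s : R) :
  0 < alpha -> 0 < beta -> 0 <= s ->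
  exists B : R, 0 <= B /\ forall x y : R -> R,
    is_solution alpha beta x y -> Rabs (x t - p1) <= 1 -> y t <= 1 ->
    Rabs (y (t + s) - y t * growth alpha beta p1 s)
      <= B * ((Rabs (x t - p1) + y t) * y t) /\
    Rabs (x (t + s) - (x t + beta * s) + y t * RInt (growth alpha beta p1) 0 s)
      <= B * ((Rabs (x t - p1) + y t) * y t).
Proof.
  intros Hal Hbe Hs.
  set (K := Rabs p1 + 1 + beta * s).
  set (C := exp (alpha * K * s)).
  pose proof (Rabs_pos p1) as Hp1.
  assert (HK : 0 <= K) by (unfold K; nra).
  assert (HC : 0 < C) by apply exp_pos.
  assert (HCs : 0 <= C * s) by nra.
  set (K2 := K + (1 + C * s)).
  set (B1 := K2 * (alpha * C) ^ 2 + alpha * (1 + C * s) * C).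
  assert (HB1 : 0 <= B1).
  { unfold B1. apply Rplus_le_le_0_compat.
    - apply Rmult_le_pos; [unfold K2; lra | apply pow2_ge_0].
    - repeat apply Rmult_le_pos; lra. }
  set (B2 := C * (C * B1 * s)).
  assert (HB2 : 0 <= B2) by (unfold B2; repeat apply Rmult_le_pos; lra).
  exists (B2 + B2 * s). split; [nra |].
  intros x y H Hd Hn.
  set (d := Rabs (x t - p1)) in *. set (n := y t) in *.
  assert (Hd0 : 0 <= d) by apply Rabs_pos.
  assert (Hn0 : 0 <= n) by apply H.
  set (Q := (d + n) * n).
  assert (HQ : 0 <= Q) by (unfold Q; nra).
  assert (HxK : forall r, t <= r <= t + s -> x r <= K).
  { intros r Hr. pose proof (abscissa_le alpha beta x y t r H ltac:(lra)).
    apply Rabs_le_between in Hd. pose proof (Rle_abs p1). unfold K. nra. }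
  assert (Hy : forall r, t <= r <= t + s -> 0 <= y r <= C * n).
  { intros r Hr. split; [apply H |].
    apply Rle_trans with (n * exp (alpha * K * (r - t))).
    - apply (height_le alpha beta x y); auto; [lra |]. intros u Hu. apply HxK; lra.
    - rewrite Rmult_comm. apply Rmult_le_compat_r; [exact Hn0 |].
      unfold C. assert (L : alpha * K * (r - t) <= alpha * K * s).
      { apply Rmult_le_compat_l; [nra | lra]. }
      destruct L as [L | ->]; [now apply Rlt_le, exp_increasing | lra]. }
  assert (Hx : forall r, t <= r <= t + s ->
    Rabs (x r - (p1 + beta * (r - t))) <= d + C * s * n).
  { intros r Hr.
    assert (E : Rabs ((x r - beta * (r - t)) - (x t - beta * (t - t))) <= C * n * (r - t)).
    { apply (increment_abs_le (fun r => x r - beta * (r - t)) (fun r => - y r)); [lra | |].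
      - intros u _. destruct (H u) as [_ [Hdx _]]. auto_derive; [now exists (beta - y u) |].
        rewrite (is_derive_unique (fun x0 : R => x x0) _ _ Hdx). ring.
      - intros u Hu. destruct (Hy u ltac:(lra)). rewrite Rabs_Ropp, Rabs_right; lra. }
    replace (x r - (p1 + beta * (r - t)))
      with ((x t - p1) + ((x r - beta * (r - t)) - (x t - beta * (t - t)))) by ring.
    eapply Rle_trans; [apply Rabs_triang |]. fold d.
    assert (C * n * (r - t) <= C * n * s) by (apply Rmult_le_compat_l; nra).
    lra. }
  assert (Hg : forall r, t <= r <= t + s ->
    exp (log_growth alpha beta p1 (r - t)) <= C /\
    exp (- log_growth alpha beta p1 (r - t)) <= C).
  { intros r Hr.
    pose proof (log_growth_abs_le alpha beta p1 s (r - t) Hal Hbe ltac:(lra)) as L.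
    fold K in L. apply Rabs_le_between in L. unfold C.
    assert (M : forall u v, u <= v -> exp u <= exp v).
    { intros u v [Huv | ->]; [now apply Rlt_le, exp_increasing | lra]. }
    split; apply M; lra. }
  (* The derivative of the height, minus its linear part. *)
  assert (Hres : forall r, t <= r <= t + s ->
    Rabs (x r * (1 - exp (- (alpha * y r))) - alpha * (p1 + beta * (r - t)) * y r)
      <= B1 * Q).
  { intros r Hr. specialize (Hx r Hr). specialize (Hy r Hr). specialize (HxK r Hr).
    set (m := p1 + beta * (r - t)) in *. set (e := d + C * s * n) in *.
    assert (He : 0 <= e <= (1 + C * s) * (d + n)).
    { unfold e. assert (0 <= C * s * n) by nra. assert (0 <= C * s * d) by nra. lra. }
    assert (HmK : Rabs m <= K).
    { unfold m, K. eapply Rle_trans; [apply Rabs_triang |].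
      rewrite Rabs_mult, (Rabs_right beta), (Rabs_right (r - t)) by lra. nra. }
    assert (HxK2 : Rabs (x r) <= K2).
    { replace (x r) with (m + (x r - m)) by ring.
      eapply Rle_trans; [apply Rabs_triang |]. unfold K2. unfold e in *. nra. }
    set (f := 1 - exp (- (alpha * y r))).
    replace (x r * f - alpha * m * y r)
      with (x r * (f - alpha * y r) + alpha * (x r - m) * y r) by ring.
    eapply Rle_trans; [apply Rabs_triang |].
    rewrite !Rabs_mult, (Rabs_right alpha), (Rabs_right (y r)) by lra.
    assert (Hay : 0 <= alpha * y r <= alpha * C * n).
    { split; [nra |]. rewrite Rmult_assoc. apply Rmult_le_compat_l; lra. }
    assert (T1 : Rabs (f - alpha * y r) <= (alpha * C) ^ 2 * n ^ 2).
    { unfold f. eapply Rle_trans; [apply exp_opp_taylor; lra |].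
      rewrite <- Rpow_mult_distr. apply pow_incr. lra. }
    assert (Hn2 : n ^ 2 <= Q) by (unfold Q; nra).
    assert (T2 : Rabs (x r) * Rabs (f - alpha * y r) <= K2 * ((alpha * C) ^ 2 * Q)).
    { apply Rmult_le_compat; try apply Rabs_pos; [exact HxK2 |].
      eapply Rle_trans; [exact T1 |].
      apply Rmult_le_compat_l; [apply pow2_ge_0 | exact Hn2]. }
    assert (T3 : alpha * Rabs (x r - m) * y r <= alpha * ((1 + C * s) * (d + n)) * (C * n)).
    { apply Rmult_le_compat; [| lra | | lra].
      - apply Rmult_le_pos; [lra | apply Rabs_pos].
      - apply Rmult_le_compat_l; lra. }
    replace (B1 * Q) with (K2 * ((alpha * C) ^ 2 * Q)
      + alpha * ((1 + C * s) * (d + n)) * (C * n)) by (unfold B1, Q; ring).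
    lra. }
  (* Dividing by the growth factor removes the linear part. *)
  assert (HyE : forall r, t <= r <= t + s ->
    Rabs (y r - n * growth alpha beta p1 (r - t)) <= B2 * Q).
  { intros r Hr.
    assert (E : Rabs (y r * exp (- log_growth alpha beta p1 (r - t))
        - y t * exp (- log_growth alpha beta p1 (t - t))) <= C * B1 * Q * (r - t)).
    { apply (increment_abs_le (fun r => y r * exp (- log_growth alpha beta p1 (r - t)))
        (fun r => (x r * (1 - exp (- (alpha * y r)))
                   - alpha * (p1 + beta * (r - t)) * y r)
                  * exp (- log_growth alpha beta p1 (r - t)))); [lra | |].
      - intros u _. destruct (H u) as [_ [_ Hdy]].
        pose proof (is_derive_log_growth alpha beta p1 t u) as Hl.
        set (g := fun r => log_growth alpha beta p1 (r - t)) in *.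
        change (is_derive (fun r => y r * exp (- g r)) u
          ((x u * (1 - exp (- (alpha * y u))) - alpha * (p1 + beta * (u - t)) * y u)
           * exp (- g u))).
        auto_derive; [repeat split; eexists; eassumption |].
        rewrite (is_derive_unique (fun x0 : R => y x0) _ _ Hdy),
          (is_derive_unique (fun x0 : R => g x0) _ _ Hl). ring.
      - intros u Hu. rewrite Rabs_mult.
        destruct (Hg u ltac:(lra)) as [_ Hgu].
        rewrite (Rabs_right (exp _)) by (apply Rle_ge, Rlt_le, exp_pos).
        replace (C * B1 * Q) with (B1 * Q * C) by ring.
        apply Rmult_le_compat; [apply Rabs_pos | apply Rlt_le, exp_pos | | exact Hgu].
        apply Hres. lra. }
    replace (log_growth alpha beta p1 (t - t)) with 0 in E by (unfold log_growth; field).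
    rewrite Ropp_0, exp_0, Rmult_1_r in E. fold n in E.
    unfold growth. destruct (Hg r Hr) as [Hgr _].
    set (g := log_growth alpha beta p1 (r - t)) in *.
    assert (Eg : exp (- g) * exp g = 1).
    { rewrite <- exp_plus, <- exp_0. f_equal. ring. }
    replace (y r - n * exp g) with (exp g * (y r * exp (- g) - n))
      by (rewrite Rmult_minus_distr_l;
          replace (exp g * (y r * exp (- g))) with (y r * (exp (- g) * exp g)) by ring;
          rewrite Eg; ring).
    rewrite Rabs_mult, (Rabs_right (exp g)) by (apply Rle_ge, Rlt_le, exp_pos).
    replace (B2 * Q) with (C * (C * B1 * Q * s)) by (unfold B2; ring).
    apply Rmult_le_compat; [apply Rlt_le, exp_pos | apply Rabs_pos | exact Hgr |].
    eapply Rle_trans; [exact E |].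
    apply Rmult_le_compat_l; [repeat apply Rmult_le_pos; lra | lra]. }
  assert (HBQ : 0 <= B2 * Q) by now apply Rmult_le_pos.
  split.
  - eapply Rle_trans.
    + specialize (HyE (t + s) ltac:(lra)). replace (t + s - t) with s in HyE by ring.
      exact HyE.
    + nra.
  - set (I := RInt (growth alpha beta p1) 0).
    assert (E : Rabs ((x (t + s) - beta * (t + s) + n * I (t + s - t))
      - (x t - beta * t + n * I (t - t))) <= B2 * Q * (t + s - t)).
    { apply (increment_abs_le (fun r => x r - beta * r + n * I (r - t))
        (fun r => - (y r - n * growth alpha beta p1 (r - t)))); [lra | |].
      - intros u _. destruct (H u) as [_ [Hdx _]].
        pose proof (is_derive_RInt_growth alpha beta p1 t u) as HI. fold I in HI.
        set (J := fun r => I (r - t)) in *.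
        change (is_derive (fun r => x r - beta * r + n * J r) u
          (- (y u - n * growth alpha beta p1 (u - t)))).
        auto_derive; [repeat split; eexists; eassumption |].
        rewrite (is_derive_unique (fun x0 : R => x x0) _ _ Hdx),
          (is_derive_unique (fun x0 : R => J x0) _ _ HI). ring.
      - intros u Hu. rewrite Rabs_Ropp. now apply HyE. }
    replace (t + s - t) with s in E by ring. rewrite Rminus_diag in E.
    replace (I 0) with 0 in E by (symmetry; apply (RInt_point 0 (growth alpha beta p1))).
    replace (x (t + s) - (x t + beta * s) + n * I s)
      with (x (t + s) - beta * (t + s) + n * I s - (x t - beta * t + n * 0)) by ring.
    eapply Rle_trans; [exact E |]. nra.
Qed.

Lemma norm_pair_le (a b : R) : norm ((a, b) : R * R) <= Rabs a + Rabs b.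
Proof.
  pose proof (Rabs_pos a). pose proof (Rabs_pos b).
  change (sqrt (Rabs a ^ 2 + Rabs b ^ 2) <= Rabs a + Rabs b).
  rewrite <- (sqrt_pow2 (Rabs a + Rabs b)) by lra.
  apply sqrt_le_1_alt. nra.
Qed.

Lemma Rabs_fst_le_norm (z : R * R) : Rabs (fst z) <= norm z.
Proof.
  destruct z as [a b]. destruct (norm_prod (a : R) (b : R)) as [H _].
  eapply Rle_trans; [apply Rmax_l | exact H].
Qed.

Lemma Rabs_snd_le_norm (z : R * R) : Rabs (snd z) <= norm z.
Proof.
  destruct z as [a b]. destruct (norm_prod (a : R) (b : R)) as [H _].
  eapply Rle_trans; [apply Rmax_r | exact H].
Qed.

Lemma norm_vertical (c : R) : norm ((0, c) : R * R) = Rabs c.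
Proof.
  apply Rle_antisym; [| apply (Rabs_snd_le_norm (0, c))].
  eapply Rle_trans; [apply norm_pair_le |]. rewrite Rabs_R0. lra.
Qed.

Lemma scal_upward (c : R) : scal c ((0, 1) : R * R) = (0, c).
Proof.
  apply injective_projections; [apply Rmult_0_r | apply Rmult_1_r].
Qed.

(** Derivative at (p1, 0) of the flow over a time [s]: the fundamental matrix of
    the variational equation. *)
Definition flow_differential (alpha beta p1 s : R) (n : R * R) : R * R :=
  (fst n - snd n * RInt (growth alpha beta p1) 0 s,
   snd n * growth alpha beta p1 s).

Lemma flow_differential_linear (alpha beta p1 s : R) :
  is_linear (flow_differential alpha beta p1 s).
Proof.
  unfold flow_differential.
  set (I := RInt (growth alpha beta p1) 0 s). set (E := growth alpha beta p1 s).
  split.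
  - intros [a1 a2] [b1 b2]. apply injective_projections.
    + change (a1 + b1 - (a2 + b2) * I = a1 - a2 * I + (b1 - b2 * I)). ring.
    + change ((a2 + b2) * E = a2 * E + b2 * E). ring.
  - intros k [a1 a2]. apply injective_projections.
    + change (k * a1 - k * a2 * I = k * (a1 - a2 * I)). ring.
    + change (k * a2 * E = k * (a2 * E)). ring.
  - exists (1 + Rabs I + Rabs E).
    pose proof (Rabs_pos I). pose proof (Rabs_pos E).
    split; [lra |]. intros [z1 z2].
    change (norm ((z1 - z2 * I, z2 * E) : R * R)
      <= (1 + Rabs I + Rabs E) * norm ((z1, z2) : R * R)).
    pose proof (Rabs_fst_le_norm (z1, z2)) as H1.
    pose proof (Rabs_snd_le_norm (z1, z2)) as H2.
    simpl fst in H1. simpl snd in H2.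
    set (N := norm ((z1, z2) : R * R)) in *.
    eapply Rle_trans; [apply norm_pair_le |].
    rewrite Rabs_mult. eapply Rle_trans; [apply Rplus_le_compat_r, Rabs_triang |].
    rewrite Rabs_Ropp, Rabs_mult.
    assert (Rabs z2 * Rabs I <= N * Rabs I) by (apply Rmult_le_compat_r; lra).
    assert (Rabs z2 * Rabs E <= N * Rabs E) by (apply Rmult_le_compat_r; lra).
    lra.
Qed.

Lemma within_lim_eq (D : R * R -> Prop) (p q : R * R) :
  D p -> is_filter_lim (within D (locally p)) q -> q = p.
Proof.
  intros Hp H. apply (eq_close (K := R_AbsRing) (V := prod_NormedModule R_AbsRing
    R_NormedModule R_NormedModule)).
  intros eps. destruct (H (ball q eps) (locally_ball q eps)) as [d Hd].
  apply Hd; [apply ball_center | exact Hp].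
Qed.

Lemma flow_filterdiff (alpha beta : R) (phi : R -> R -> R * R -> R * R) (p1 t s : R) :
  0 < alpha -> 0 < beta -> is_flow alpha beta phi -> 0 <= s ->
  filterdiff (phi t (t + s)) (within phase_space (locally (p1, 0)))
    (flow_differential alpha beta p1 s).
Proof.
  intros Hal Hbe Hphi Hs.
  assert (Hp : phase_space (p1, 0)) by (unfold phase_space; simpl; lra).
  destruct (variation_estimate alpha beta p1 t s Hal Hbe Hs) as [B [HB Hest]].
  split; [apply flow_differential_linear |].
  intros q Hq. apply (within_lim_eq phase_space) in Hq; [subst q | exact Hp].
  intros eps.
  pose proof (cond_pos eps) as Heps.
  assert (Hdp : 0 < Rmin 1 (eps / (4 * B + 1))).
  { apply Rmin_glb_lt; [lra |]. apply Rdiv_lt_0_compat; lra. }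
  (* On the [delta]-ball the remainder is at most 4 * B * delta times the norm. *)
  set (delta := mkposreal _ Hdp).
  assert (Hd1 : delta <= 1) by (simpl; apply Rmin_l).
  assert (Hd2 : 4 * B * delta <= eps).
  { assert (delta <= eps / (4 * B + 1)) by (simpl; apply Rmin_r).
    assert ((4 * B + 1) * (eps / (4 * B + 1)) = eps) by (field; lra).
    pose proof (cond_pos delta). nra. }
  exists delta. intros z. change (R * R)%type in z. intros [Hb1 Hb2] Hz.
  change (Rabs (fst z - p1) < delta) in Hb1.
  change (Rabs (snd z - 0) < delta) in Hb2.
  assert (Hzz : 0 <= snd z) by exact Hz.
  rewrite Rminus_0_r, Rabs_right in Hb2 by lra.
  pose proof (flow_solution alpha beta phi t z Hphi Hz) as Sz.
  pose proof (flow_solution alpha beta phi t _ Hphi Hp) as Sp.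
  (* The base point moves along the invariant manifold. *)
  assert (Ep : phi t (t + s) (p1, 0) = (p1 + beta * s, 0)).
  { destruct (solution_unique alpha beta _ _ _ _ t (t + s) Hal Sp
      (solution_on_manifold alpha beta p1 t)) as [E1 E2].
    - destruct (Hphi t _ Hp) as [-> _]. simpl. ring.
    - now destruct (Hphi t _ Hp) as [-> _].
    - apply injective_projections; simpl in *; [rewrite E1; ring | exact E2]. }
  destruct (Hphi t z Hz) as [Ez _].
  destruct (Hest _ _ Sz) as [R2 R1]; [rewrite Ez; lra .. |].
  rewrite Ez in R1, R2. rewrite Ep.
  set (E := growth alpha beta p1 s) in *.
  set (I := RInt (growth alpha beta p1) 0 s) in *.
  set (w := phi t (t + s) z) in *.
  assert (Hn : snd z <= norm (minus z (p1, 0))).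
  { eapply Rle_trans; [| apply Rabs_snd_le_norm].
    change (snd z <= Rabs (snd z - 0)). rewrite Rminus_0_r. apply Rle_abs. }
  assert (Er : minus (minus w (p1 + beta * s, 0))
      (flow_differential alpha beta p1 s (minus z (p1, 0)))
    = ((fst w - (fst z + beta * s) + snd z * I, snd w - snd z * E) : R * R)).
  { apply injective_projections.
    - change (fst w - (p1 + beta * s) - (fst z - p1 - (snd z - 0) * I)
        = fst w - (fst z + beta * s) + snd z * I). ring.
    - change (snd w - 0 - (snd z - 0) * E = snd w - snd z * E). ring. }
  set (n := norm (minus z (p1, 0))) in *.
  eapply Rle_trans; [apply Req_le, (f_equal norm Er) |].
  change (norm ((fst w - (fst z + beta * s) + snd z * I, snd w - snd z * E) : R * R)
    <= eps * n).
  eapply Rle_trans; [apply norm_pair_le |].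
  pose proof (Rabs_pos (fst z - p1)) as Hd0.
  assert (Hq : (Rabs (fst z - p1) + snd z) * snd z <= 2 * delta * n).
  { apply Rmult_le_compat; lra. }
  assert (HBq : B * ((Rabs (fst z - p1) + snd z) * snd z) <= B * (2 * delta * n))
    by now apply Rmult_le_compat_l.
  assert (4 * B * delta * n <= eps * n) by (apply Rmult_le_compat_r; lra).
  lra.
Qed.

(** A differential within the half-plane is determined on inward vectors, in
    particular on the upward normal. *)
Lemma filterdiff_vertical_unique (f L1 L2 : R * R -> R * R) (p : R * R) :
  phase_space p ->
  filterdiff f (within phase_space (locally p)) L1 ->
  filterdiff f (within phase_space (locally p)) L2 ->
  snd (L1 (0, 1)) = snd (L2 (0, 1)).
Proof.
  intros Hp [Hl1 H1] [Hl2 H2].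
  assert (Hlim : is_filter_lim (within phase_space (locally p)) p).
  { intros P HP. now apply filter_le_within. }
  specialize (H1 p Hlim). specialize (H2 p Hlim).
  apply cond_eq. intros e He.
  assert (He3 : 0 < e / 3) by lra.
  destruct (H1 (mkposreal _ He3)) as [d1 Hd1].
  destruct (H2 (mkposreal _ He3)) as [d2 Hd2].
  pose proof (cond_pos d1). pose proof (cond_pos d2).
  set (h := Rmin d1 d2 / 2).
  assert (Hh : 0 < h /\ h < d1 /\ h < d2).
  { unfold h. pose proof (Rmin_l d1 d2). pose proof (Rmin_r d1 d2).
    assert (0 < Rmin d1 d2) by (apply Rmin_glb_lt; lra). lra. }
  set (z := (fst p, snd p + h)).
  assert (Ez : minus z p = scal h ((0, 1) : R * R)).
  { apply injective_projections.
    - change (fst p - fst p = h * 0). ring.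
    - change (snd p + h - snd p = h * 1). ring. }
  assert (Hz : phase_space z) by (unfold phase_space, z in *; simpl; lra).
  assert (Hball : forall d : posreal, h < d -> ball p d z).
  { intros d Hd. split; simpl.
    - apply ball_center.
    - change (Rabs (snd p + h - snd p) < d).
      replace (snd p + h - snd p) with h by ring. rewrite Rabs_right; lra. }
  specialize (Hd1 z (Hball d1 ltac:(lra)) Hz). specialize (Hd2 z (Hball d2 ltac:(lra)) Hz).
  assert (G : forall L : R * R -> R * R, is_linear L ->
    norm (minus (minus (f z) (f p)) (L (minus z p))) <= e / 3 * norm (minus z p) ->
    Rabs (snd (f z) - snd (f p) - h * snd (L (0, 1))) <= e / 3 * h).
  { intros L HL HdL. rewrite Ez, (linear_scal L HL) in HdL.
    rewrite scal_upward, norm_vertical, (Rabs_right h) in HdL by lra.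
    eapply Rle_trans; [| exact HdL].
    exact (Rabs_snd_le_norm (minus (minus (f z) (f p)) (scal h (L (0, 1))))). }
  pose proof (G L1 Hl1 Hd1) as G1. pose proof (G L2 Hl2 Hd2) as G2.
  apply Rabs_le_between in G1. apply Rabs_le_between in G2.
  apply Rabs_def1; apply Rmult_lt_reg_l with h; nra.
Qed.

(** * The normal infinitesimal Lyapunov exponent *)

Lemma normal_iff (n : R * R) : normal n <-> fst n = 0.
Proof.
  unfold normal, dot, tangent, invariant_manifold. split.
  - intros H. specialize (H (1, 0) eq_refl). simpl in H. lra.
  - intros H u Hu. rewrite H, Hu. ring.
Qed.

(** The unit normal vectors are (0, 1) and (0, -1), and give the same value. *)
Lemma normal_opnorm_linear (L : R * R -> R * R) :
  is_linear L -> normal_opnorm L = Rabs (snd (L (0, 1))).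
Proof.
  intros HL. unfold normal_opnorm.
  rewrite (is_lub_Rbar_unique _ (Finite (Rabs (snd (L (0, 1)))))); [reflexivity |].
  split.
  - intros r [[n1 n2] [Hn [Hn1 ->]]]. apply normal_iff in Hn. simpl in Hn. subst n1.
    rewrite norm_vertical in Hn1. unfold normal_proj. rewrite norm_vertical.
    rewrite <- scal_upward, (linear_scal L HL).
    change (Rabs (n2 * snd (L (0, 1))) <= Rabs (snd (L (0, 1)))).
    rewrite Rabs_mult, Hn1. lra.
  - intros l Hl. apply Hl. exists (0, 1). split; [now apply normal_iff |].
    rewrite norm_vertical, Rabs_R1. split; [reflexivity |].
    unfold normal_proj. now rewrite norm_vertical.
Qed.

Lemma normal_growth_rate (alpha beta : R) (phi : R -> R -> R * R -> R * R)
    (p1 t s : R) (L : R * R -> R * R) :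
  0 < alpha -> 0 < beta -> is_flow alpha beta phi -> 0 < s ->
  filterdiff (phi t (t + s)) (within phase_space (locally (p1, 0))) L ->
  1 / s * ln (normal_opnorm L) = alpha * (p1 + beta * s / 2).
Proof.
  intros Hal Hbe Hphi Hs HL.
  rewrite normal_opnorm_linear by apply HL.
  rewrite (filterdiff_vertical_unique (phi t (t + s)) L
    (flow_differential alpha beta p1 s) (p1, 0)).
  - unfold flow_differential; simpl. rewrite Rmult_1_l. unfold growth.
    rewrite Rabs_right by (apply Rle_ge, Rlt_le, exp_pos).
    rewrite ln_exp. unfold log_growth. field. lra.
  - unfold phase_space; simpl; lra.
  - exact HL.
  - apply flow_filterdiff; auto; lra.
Qed.

(** Both the existence and the uniqueness of the limit defining the exponent. *)
Lemma is_NILE_iff (alpha beta : R) (phi : R -> R -> R * R -> R * R) (p1 t l : R) :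
  0 < alpha -> 0 < beta -> is_flow alpha beta phi ->
  is_NILE phi (p1, 0) t l <-> l = alpha * p1.
Proof.
  intros Hal Hbe Hphi.
  assert (Hlim : forall L : R -> R * R -> R * R,
    (forall s, 0 < s ->
      filterdiff (phi t (t + s)) (within phase_space (locally (p1, 0))) (L s)) ->
    filterlim (fun s => 1 / s * ln (normal_opnorm (L s))) (at_right 0)
      (locally (alpha * p1))).
  { intros L HL.
    apply (filterlim_ext_loc (fun s => alpha * (p1 + beta * s / 2))).
    - exists (mkposreal 1 Rlt_0_1). intros s _ Hs. symmetry.
      apply (normal_growth_rate alpha beta phi p1 t s); auto.
    - replace (alpha * p1) with (alpha * (p1 + beta * 0 / 2)) by field.
      apply (filterlim_filter_le_1 _ (filter_le_within _)).
      apply (ex_derive_continuous (fun s : R => alpha * (p1 + beta * s / 2))).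
      auto_derive. auto. }
  split.
  - intros [L [HL Hl]]. specialize (Hlim L HL).
    exact (filterlim_locally_unique _ _ _ Hl Hlim).
  - intros ->. exists (flow_differential alpha beta p1).
    assert (HL : forall s, 0 < s -> filterdiff (phi t (t + s))
      (within phase_space (locally (p1, 0))) (flow_differential alpha beta p1 s)).
    { intros s Hs. apply flow_filterdiff; auto; lra. }
    split; [exact HL | exact (Hlim _ HL)].
Qed.

(** The exponent is the normal component alpha * z_1 of the Jacobian. *)
Lemma NILE_value (alpha beta : R) (phi : R -> R -> R * R -> R * R) (p1 t : R) :
  0 < alpha -> 0 < beta -> is_flow alpha beta phi ->
  NILE phi (p1, 0) t = alpha * p1.
Proof.
  intros Hal Hbe Hphi. unfold NILE.
  apply (iota_unique (V := R_CompleteNormedModule)).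
  - intros l Hl. exact (proj1 (is_NILE_iff alpha beta phi p1 t l Hal Hbe Hphi) Hl).
  - now apply (is_NILE_iff alpha beta phi).
Qed.

(** [is_RInt] gives both the integrability of the exponent along [gamma] and the
    value of the balance function. *)
Lemma NILE_balance_value (alpha beta b t0 : R) (phi : R -> R -> R * R -> R * R) (t : R) :
  0 < alpha -> 0 < beta -> is_flow alpha beta phi ->
  is_RInt (fun s => NILE phi (gamma beta b t0 s) s) t0 t
    (alpha * ((t - t0) * (beta * (t - t0) / 2 - b))).
Proof.
  intros Hal Hbe Hphi.
  apply (is_RInt_ext (fun s => alpha * (beta * (s - t0) - b))).
  { intros s _. symmetry. now apply (NILE_value alpha beta phi). }
  set (G := fun s => alpha * ((s - t0) * (beta * (s - t0) / 2 - b))).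
  replace (alpha * ((t - t0) * (beta * (t - t0) / 2 - b))) with (minus (G t) (G t0))
    by (unfold G, minus, plus, opp; simpl; field).
  apply (is_RInt_derive G); intros s _.
  - unfold G. auto_derive; [auto | field].
  - apply (ex_derive_continuous (fun s : R => alpha * (beta * (s - t0) - b))).
    auto_derive. auto.
Qed.

(** * Entry-exit relationship *)

Theorem proposition4p4 (alpha beta b t0 : R)
  (halpha : 0 < alpha) (hbeta : 0 < beta) (hb : 0 < b)
  (phi : R -> R -> R * R -> R * R) (hphi : is_flow alpha beta phi) :
  (forall t : R, phi t0 t (- b, 0) = gamma beta b t0 t) /\
  (forall s : R, t0 <= s ->
     is_NILE phi (gamma beta b t0 s) s (NILE phi (gamma beta b t0 s) s)) /\
  (forall t : R, t0 <= t ->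
     ex_RInt (fun s : R => NILE phi (gamma beta b t0 s) s) t0 t) /\
  exists T : R,
    first_zero_after (NILE_balance phi beta b t0) t0 T /\
    T = t0 + 2 * b / beta /\
    gamma beta b t0 T = (b, 0) /\
    correct_exit_point phi b t0 (gamma beta b t0 T).
Proof.
  assert (HF : forall t, NILE_balance phi beta b t0 t
    = alpha * ((t - t0) * (beta * (t - t0) / 2 - b))).
  { intros t. apply (is_RInt_unique (V := R_CompleteNormedModule)).
    now apply NILE_balance_value. }
  split; [| split; [| split]].
  - intros t.
    assert (Hp : phase_space (- b, 0)) by (unfold phase_space; simpl; lra).
    destruct (hphi t0 _ Hp) as [E0 _].
    destruct (solution_unique alpha beta _ _ _ _ t0 t halpha
      (flow_solution alpha beta phi t0 _ hphi Hp)
      (solution_on_manifold alpha beta (- b) t0)) as [E1 E2].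
    + rewrite E0. simpl. ring.
    + now rewrite E0.
    + apply injective_projections; simpl in *; [rewrite E1; ring | exact E2].
  - intros s _. apply (is_NILE_iff alpha beta phi); auto.
    now apply (NILE_value alpha beta phi).
  - intros t _. eexists. now apply (NILE_balance_value alpha beta b t0 phi t).
  - exists (t0 + 2 * b / beta).
    assert (HT : 0 < 2 * b / beta) by (apply Rdiv_lt_0_compat; lra).
    assert (HTb : beta * (2 * b / beta) = 2 * b) by (field; lra).
    assert (Eg : gamma beta b t0 (t0 + 2 * b / beta) = (b, 0)).
    { unfold gamma. f_equal. field. lra. }
    split; [| split; [reflexivity | split; [exact Eg |]]].
    + split; [lra | split].
      * rewrite HF. field. lra.
      * intros t Ht. rewrite HF.
        repeat apply Rmult_integral_contrapositive_currified; nra.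
    + rewrite Eg. split; [reflexivity |].
      (* Below height [beta] the first component of the field is positive. *)
      exists beta. split; [exact hbeta |]. intros chi Hchi.
      assert (Hp : phase_space (- b, chi)) by (unfold phase_space; simpl; lra).
      destruct (hphi t0 _ Hp) as [E0 _].
      destruct (exit_point_solution alpha beta b chi t0 _ _ halpha hb Hchi
        (flow_solution alpha beta phi t0 _ hphi Hp)) as [Hin [Tx [Hout [Ex Ey]]]].
      * now rewrite E0.
      * now rewrite E0.
      * split; [exact Hin |]. exists Tx. split; [exact Hout |].
        now apply injective_projections.
Qed.
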